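(* For any graphs $G$ and $H$, $\ell_G\, \ell_H \leq \gamma_P(G \Box H)$. Moreover, if $\ell_G = \gamma_P(G)$ and $\ell_H = \gamma_P(H)$, then $\gamma_P(G)\,\gamma_P(H) \leq \gamma_P(G \Box H)$.
   Context: All graphs are simple and finite, with nonempty vertex set. For a graph $G$ and $S\subseteq V(G)$, vertices are observed by the following rules. Initialization (domination) step, applied once: all vertices in $S$ and all neighbors of vertices in $S$ are observed. Propagation (zero forcing) step, applied repeatedly until no further vertex can be observed: every vertex which is the only unobserved neighbor of some observed vertex becomes observed. The set $S$ is a power dominating set of $G$ (one says $S$ power dominates $G$) if every vertex of $G$ is eventually observed. The power domination number $\gamma_P(G)$ is the minimum cardinality of a power dominating set of $G$. A partition $\Pi = \Pi_1 \cup \cdots \cup \Pi_k$ of $V(G)$ with $k\ge 2$ is a failed power dominating partition of $G$ if for each $i\in\{1,\dots,k\}$, the set $V(G)-\Pi_i$ does not power dominate $G$. If such a partition exists, $\ell_G$ is the maximum $j$ such that $G$ has a failed power dominating partition $\Pi_1\cup\cdots\cup\Pi_j$ into $j$ parts; if no such partition exists, $\ell_G=1$. The Cartesian product $G\Box H$ has vertex set $\{(g,h) : g\in V(G), h\in V(H)\}$; two vertices $(g_1,h_1)$ and $(g_2,h_2)$ are adjacent if either $g_1=g_2$ and $h_1h_2\in E(H)$, or $h_1=h_2$ and $g_1g_2\in E(G)$. *)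

(* Defs.v *)
From mathcomp Require Import all_boot.

Set Implicit Arguments.
Unset Strict Implicit.
Unset Printing Implicit Defensive.

Record graph := Graph {
  vertex :> finType;
  adj : rel vertex;
  adj_sym : symmetric adj;
  adj_irr : irreflexive adj;
  vertex_gt0 : 0 < #|vertex|
}.

Section PowerDomination.

Variable G : graph.
Implicit Types (S O X : {set G}) (P : {set {set G}}).

Definition open_nbhd (v : G) : {set G} := [set w | adj v w].

Definition domination_step S : {set G} :=
  S :|: \bigcup_(v in S) open_nbhd v.

(* All the forces available from [O] are performed at once. *)
Definition propagation_step O : {set G} :=
  O :|: [set v | [exists u in O, open_nbhd u :\: O == [set v]]].

(* [#|G|] rounds suffice to reach a fixed point, see [observed_stable]. *)
Definition observed S : {set G} :=
  iter #|G| propagation_step (domination_step S).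

Definition power_dominating S : bool := observed S == [set: G].

Lemma iter_propagation_sub n O : O \subset iter n propagation_step O.
Proof.
elim: n => [|n IHn] //=.
by apply: subset_trans IHn _; apply: subsetUl.
Qed.

Lemma observed_stable S : propagation_step (observed S) = observed S.
Proof.
rewrite /observed; set D := domination_step S.
pose it n := iter n propagation_step D.
have key n : propagation_step (it n) = it n \/ n < #|it n.+1|.
  elim: n => [|n [IHn|IHn]].
  - have [->|] := eqVneq (propagation_step (it 0)) (it 0); first by left.
    move=> neq; right.
    suff: it 0 \proper it 1 by move/proper_card; apply: leq_ltn_trans.
    by rewrite properEneq eq_sym neq subsetUl.
  - by left; rewrite /it /= -/(it n) !IHn.
  - have [->|] := eqVneq (propagation_step (it n.+1)) (it n.+1); first by left.
    move=> neq; right.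
    suff: it n.+1 \proper it n.+2 by move/proper_card; apply: leq_ltn_trans.
    by rewrite properEneq eq_sym neq subsetUl.
have [//|] := key #|G|.
by rewrite ltnNge max_card.
Qed.

Lemma power_dominatingT : power_dominating [set: G].
Proof.
rewrite /power_dominating eqEsubset subsetT /=.
apply: subset_trans (iter_propagation_sub _ _).
exact: subsetUl.
Qed.

(* The default [[set: G]] is power dominating, see [power_dominatingT]. *)
Definition power_domination_number : nat :=
  #|[arg min_(S < [set: G] | power_dominating S) #|S|]|.

(* [partition] excludes empty blocks; an empty block could not occur anyway,
   its complement being power dominating. *)
Definition failed_pd_partition P : bool :=
  [&& partition P [set: G], 1 < #|P|
    & [forall X in P, ~~ power_dominating (~: X)]].

Definition failed_partition_number : nat :=
  if [exists P, failed_pd_partition P]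
  then \max_(P | failed_pd_partition P) #|P| else 1.

End PowerDomination.

Section CartesianProduct.

Variables G H : graph.

Definition cart_adj : rel (G * H) := fun x y =>
  (x.1 == y.1) && adj x.2 y.2 || (x.2 == y.2) && adj x.1 y.1.

Lemma cart_adj_sym : symmetric cart_adj.
Proof.
by move=> x y; rewrite /cart_adj ![_ == y.1]eq_sym ![_ == y.2]eq_sym
  (adj_sym x.1) (adj_sym x.2).
Qed.

Lemma cart_adj_irr : irreflexive cart_adj.
Proof. by move=> x; rewrite /cart_adj !adj_irr !andbF. Qed.

Lemma cart_vertex_gt0 : 0 < #|{: G * H}|.
Proof. by rewrite card_prod muln_gt0 !vertex_gt0. Qed.

Definition cart_prod : graph := Graph cart_adj_sym cart_adj_irr cart_vertex_gt0.

End CartesianProduct.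

(* Main.v *)
Require Import Defs.
From mathcomp Require Import all_boot.

(** A set [S] fails to power dominate exactly when some nonempty fort avoids
    the domination step of [S] ([not_power_dominatingP]); here a fort is a set
    of vertices such that no vertex outside it has exactly one neighbour inside
    it, so that once wholly unobserved it can never be entered by a force.

    Forts multiply: if [U] and [W] are forts of [G] and [H], then [U x W] is a
    fort of the Cartesian product, because an outside vertex either has no
    neighbour in [U x W] or sees it inside a single copy of one of the factors.
    If moreover [U] witnesses the failure of the complement of [X] and [W] that
    of the complement of [Y], then every vertex of [U x W] and each of its
    neighbours lie in [X x Y]. Hence a power dominating set of the product must
    meet [X x Y] ([power_dominating_meets_cell]).

    Now take partitions of [G] and [H] into [l_G] and [l_H] parts, all having
    non power dominating complements. The [l_G * l_H] cells [X x Y] are pairwise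
    disjoint, and a power dominating set of the product has a vertex in each.
    Substituting the hypotheses of the second claim into this bound proves it. *)

Set Implicit Arguments.
Unset Strict Implicit.
Unset Printing Implicit Defensive.

Definition fort (G : graph) (U : {set G}) : bool :=
  (U != set0) && [forall v in ~: U, #|open_nbhd v :&: U| != 1].

Lemma fort_unobserved (G : graph) (S U : {set G}) :
  fort U -> [disjoint U & domination_step S] -> [disjoint U & observed S].
Proof.
case/andP=> _ /forall_inP fortU dU; rewrite /observed.
elim: #|G| => //= n; set O := iter n _ _ => dO.
rewrite disjoints_subset; apply/subsetP=> v Uv; rewrite inE; apply/negP.
rewrite !inE (disjointFr dO Uv) /= => /exists_inP[u Ou /eqP forceE].
have /fortU/negP[] : u \in ~: U by rewrite inE (disjointFl dO Ou).
apply/cards1P; exists v; apply/eqP; rewrite eqEsubset; apply/andP; split.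
  rewrite -forceE; apply/subsetP=> w /setIP[uw Uw].
  by rewrite inE uw (disjointFr dO Uw).
have : v \in open_nbhd u :\: O by rewrite forceE set11.
by rewrite sub1set !inE Uv andbT => /andP[].
Qed.

(** When [S] fails, the set of vertices that remain unobserved is itself a
    suitable fort, as no force into it is available. *)
Lemma not_power_dominatingP (G : graph) (S : {set G}) :
  reflect (exists2 U : {set G}, fort U & [disjoint U & domination_step S])
          (~~ power_dominating S).
Proof.
apply: (iffP idP) => [failS | [U fortU dU]]; last first.
  have /andP[/set0Pn[v Uv] _] := fortU.
  apply/eqP=> obsT; have := disjointFr (fort_unobserved fortU dU) Uv.
  by rewrite obsT inE.
exists (~: observed S); last first.
  by rewrite disjoint_sym disjoints_subset setCK iter_propagation_sub.
apply/andP; split.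
  by apply: contra failS => /eqP; rewrite -setCT => /setC_inj/eqP.
apply/forall_inP=> u; rewrite setCK => obs_u.
apply/negP=> /cards1P[v]; rewrite -setDE => forceE.
have : v \in open_nbhd u :\: observed S by rewrite forceE set11.
case/setDP=> _ /negP; apply; rewrite -observed_stable.
by rewrite !inE; apply/orP; right; apply/exists_inP; exists u; rewrite // forceE.
Qed.

Lemma fort_setX (G H : graph) (U : {set G}) (W : {set H}) :
  fort U -> fort W -> @fort (cart_prod G H) (setX U W).
Proof.
case/andP=> /set0Pn[u0 Uu0] /forall_inP fortU.
case/andP=> /set0Pn[w0 Ww0] /forall_inP fortW.
apply/andP; split; first by apply/set0Pn; exists (u0, w0); rewrite inE Uu0.
apply/forall_inP=> -[a b]; rewrite !inE /= negb_and.
have [Ua /= W'b | U'a _] := boolP (a \in U).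
  (* The fort is seen only inside the copy of [H] above [a]. *)
  suff -> : @open_nbhd (cart_prod G H) (a, b) :&: setX U W
          = setX [set a] (open_nbhd b :&: W).
    by rewrite cardsX cards1 mul1n fortW ?inE.
  apply/setP=> -[c d]; rewrite !inE /= /cart_adj /= (eq_sym c).
  have [<-|_] /= := eqVneq a c; first by rewrite Ua adj_irr andbF orbF.
  have [<-|//] := eqVneq b d; by rewrite (negbTE W'b) !andbF.
have [Wb | W'b] := boolP (b \in W).
  suff -> : @open_nbhd (cart_prod G H) (a, b) :&: setX U W
          = setX (open_nbhd a :&: U) [set b].
    by rewrite cardsX cards1 muln1 fortU ?inE.
  apply/setP=> -[c d]; rewrite !inE /= /cart_adj /= (eq_sym d).
  have [<-|_] /= := eqVneq b d; first by rewrite Wb adj_irr andbF !andbT.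
  have [<-|_] := eqVneq a c; by rewrite ?(negbTE U'a) !andbF.
(* A neighbour of [(a, b)] keeps [a] or [b], so none lies in [U x W]. *)
suff -> : @open_nbhd (cart_prod G H) (a, b) :&: setX U W = set0 by rewrite cards0.
apply/setP=> -[c d]; rewrite !inE /= /cart_adj /=.
have [<-|_] /= := eqVneq a c; first by rewrite (negbTE U'a) andbF.
by have [<-|//] := eqVneq b d; rewrite (negbTE W'b) !andbF.
Qed.

Lemma disjoint_domination_step (G : graph) (S U : {set G}) :
  [disjoint U & domination_step S] ->
  forall u v, u \in U -> (v == u) || adj v u -> v \notin S.
Proof.
move=> dU u v Uu vu; apply: contraFN (disjointFr dU Uu) => Sv.
rewrite inE; case/orP: vu => [/eqP<- | vu]; first by rewrite Sv.
by apply/orP; right; apply/bigcupP; exists v; rewrite ?inE.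
Qed.

Lemma power_dominating_meets_cell (G H : graph) (X : {set G}) (Y : {set H})
    (S : {set cart_prod G H}) :
  ~~ power_dominating (~: X) -> ~~ power_dominating (~: Y) ->
  power_dominating S -> exists2 s, s \in S & (s.1 \in X) && (s.2 \in Y).
Proof.
move=> /not_power_dominatingP[U fortU dU] /not_power_dominatingP[W fortW dW] pdS.
have inX u v : u \in U -> (v == u) || adj v u -> v \in X.
  by move=> Uu /(disjoint_domination_step dU Uu); rewrite inE negbK.
have inY u v : u \in W -> (v == u) || adj v u -> v \in Y.
  by move=> Wu /(disjoint_domination_step dW Wu); rewrite inE negbK.
apply/exists_inP; apply: contraLR pdS => /exists_inPn missXY.
apply/not_power_dominatingP; exists (setX U W); first exact: fort_setX.
rewrite disjoints_subset; apply/subsetP=> -[u w]; rewrite inE /= => /andP[Uu Ww].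
rewrite inE; apply/setUP=> -[/missXY | /bigcupP[[a b] /missXY]] /=.
  by rewrite (inX u) ?(inY w) ?eqxx.
rewrite inE /= /cart_adj /= => missab /orP[] /andP[E ab]; case/negP: missab.
  by rewrite (inX u) ?(inY w) ?E ?ab ?orbT.
by rewrite (inX u) ?(inY w) ?E ?ab ?orbT.
Qed.

(** The convention [l_G = 1] in the absence of a failed partition fits the
    one-block partition: its only complement is empty and observes nothing. *)
Lemma failed_partition_witness (G : graph) :
  exists P : {set {set G}},
    [/\ partition P [set: G], #|P| = failed_partition_number G
      & {in P, forall X, ~~ power_dominating (~: X)}].
Proof.
rewrite /failed_partition_number; case: ifP => [/existsP[P0 failP0] | _].
  have [|P /and3P[partP _ /forall_inP failP] ->] :=
    @eq_bigmax_cond _ (@failed_pd_partition G) (fun P => #|P|).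
    by apply/card_gt0P; exists P0.
  by exists P.
have [v _] := card_gt0P (vertex_gt0 G).
have nonempty : [set: G] != set0 by apply/set0Pn; exists v; rewrite inE.
exists [set [set: G]]; split; last first.
- move=> X /set1P->; rewrite setCT; apply/not_power_dominatingP.
  exists [set: G]; last first.
    rewrite disjoint_sym disjoints_subset.
    by rewrite /domination_step big_set0 setU0 sub0set.
  by apply/andP; split=> //; apply/forall_inP=> w; rewrite !inE.
- exact: cards1.
by rewrite /partition /trivIset /cover !big_set1 !eqxx in_set1 eq_sym.
Qed.

(** A point lies in at most one cell [X x Y], namely the one formed by the two
    blocks of its coordinates. *)
Lemma leq_card_partition_cells (T1 T2 : finType) (P : {set {set T1}})
    (Q : {set {set T2}}) (S : {set T1 * T2}) :
  trivIset P -> trivIset Q ->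
  (forall X Y, X \in P -> Y \in Q ->
     exists2 s, s \in S & (s.1 \in X) && (s.2 \in Y)) ->
  #|P| * #|Q| <= #|S|.
Proof.
move=> trivP trivQ meets; rewrite -cardsX.
pose cell (s : T1 * T2) := (pblock P s.1, pblock Q s.2).
apply: leq_trans (leq_imset_card cell S); apply: subset_leq_card.
apply/subsetP=> -[X Y]; rewrite inE /= => /andP[PX QY].
have [s Ss /andP[Xs Ys]] := meets X Y PX QY.
apply/imsetP; exists s => //.
by rewrite /cell (def_pblock trivP PX Xs) (def_pblock trivQ QY Ys).
Qed.

Theorem theorem4 (G H : graph) :
  failed_partition_number G * failed_partition_number H
    <= power_domination_number (cart_prod G H)
  /\ (failed_partition_number G = power_domination_number G ->
      failed_partition_number H = power_domination_number H ->
      power_domination_number G * power_domination_number H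
        <= power_domination_number (cart_prod G H)).
Proof.
suff bound : failed_partition_number G * failed_partition_number H
    <= power_domination_number (cart_prod G H).
  by split=> // <- <-.
have [P [/and3P[_ trivP _] <- failP]] := failed_partition_witness G.
have [Q [/and3P[_ trivQ _] <- failQ]] := failed_partition_witness H.
rewrite /power_domination_number; case: arg_minnP => [|S pdS _].
  exact: power_dominatingT.
apply: leq_card_partition_cells trivP trivQ _ => X Y /failP failX /failQ failY.
exact: power_dominating_meets_cell failX failY pdS.
Qed.
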